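(* For a nonnegative integer $k$ define $$R_k(x)=\frac{1}{x^{k-1}(1+x)^k(1-x-x^2)}-\frac{1}{x^k(1+x)^k}\sum_{n=0}^{2k}\left(F_n-S_{n,k} \right)x^n,\qquad S_{n,k}=\sum_{j=0}^{k}\binom{k}{j}q(n-k-j).$$ Then for every nonnegative integer $k$ and every real $x>0$ with $x^2+x\neq 1$, $R_{k+1}(x)-R_k(x)\leqslant 0$.
   Context: $q(n)$ denotes the number of partitions of the positive integer $n$ into odd parts; $q(0)=1$ and $q(n)=0$ for negative $n$. $F_n$ is the $n$-th Fibonacci number: $F_0=0$, $F_1=1$, $F_n=F_{n-1}+F_{n-2}$. *)

(* Defs.v *)
From HB Require Import structures.
From mathcomp Require Import all_boot all_order all_algebra.
From mathcomp Require Import reals.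

Set Implicit Arguments.
Unset Strict Implicit.
Unset Printing Implicit Defensive.

Import Order.TTheory GRing.Theory Num.Theory.

Definition odd_partition (n : nat) (s : seq nat) : bool :=
  [&& sorted geq s, all odd s & sumn s == n].

(* Parts are positive (odd), so a partition of n has at most n parts, each at
   most n: the finite type below misses none (odd_partition_bseq). *)
Definition num_odd_partitions (n : nat) : nat :=
  #|[set s : n.-bseq 'I_n.+1 | odd_partition n [seq val i | i <- s]]|.

Lemma odd_partition_bseq (n : nat) (s : seq nat) :
  odd_partition n s -> exists t : n.-bseq 'I_n.+1, s = [seq val i | i <- t].
Proof.
case/and3P=> _ odd_s /eqP sum_s.
have size_s : size s <= n.
  rewrite -sum_s; elim: s odd_s {sum_s} => //= -[|a] s IHs /andP[] // _ /IHs le_s.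
  by rewrite addSn ltnS (leq_trans le_s) ?leq_addl.
have le_s : all (fun i => i < n.+1) s.
  rewrite -sum_s; elim: s {odd_s sum_s size_s} => //= a s IHs.
  rewrite ltnS leq_addr /=; apply: sub_all IHs => i.
  by rewrite !ltnS => /leq_trans; apply; apply: leq_addl.
have size_t : size (pmap insub s : seq 'I_n.+1) <= n.
  by rewrite size_pmap_sub (leq_trans (count_size _ _)).
exists (Bseq size_t) => /=.
elim: s le_s {odd_s sum_s size_s size_t} => //= a s IHs /andP[lt_a /IHs Es].
by rewrite insubT /= -Es.
Qed.

Definition q (z : int) : nat :=
  match z with
  | Posz n => num_odd_partitions n
  | Negz _ => 0
  end.

Fixpoint fib (n : nat) : nat :=
  match n with
  | 0 => 0
  | 1 => 1
  | (m.+1 as n1).+1 => fib n1 + fib m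
  end.

Definition S_ (n k : nat) : nat :=
  \sum_(0 <= j < k.+1) 'C(k, j) * q (n%:Z - k%:Z - j%:Z)%R.

Local Open Scope ring_scope.

(* The exponent k - 1 is an integer, equal to -1 when k = 0. *)
Definition R_ (R : realType) (k : nat) (x : R) : R :=
  1 / (x ^ (k%:Z - 1) * (1 + x) ^+ k * (1 - x - x ^+ 2))
  - 1 / (x ^+ k * (1 + x) ^+ k)
    * \sum_(0 <= n < (2 * k).+1) ((fib n)%:R - (S_ n k)%:R) * x ^+ n.

(* Main.v *)
(** Clearing the denominator [x^(k+1) (1+x)^(k+1)], Pascal's rule for [S] and the
    Fibonacci recurrence make everything telescope except one term:
    [R_(k+1) - R_k = x^(2k+2) (S_(2k+1,k) - F_(2k+1)) / (x^(k+1) (1+x)^(k+1))].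
    The inequality [S_(n,k) <= F_n] for [n > 2k] follows by the same recurrences
    from [q n <= F_n], which holds for [n > 0] because [F_n] counts the
    compositions of [n] into odd parts. *)
Require Import Defs.
From HB Require Import structures.
From mathcomp Require Import all_boot all_order all_algebra.
From mathcomp Require Import reals.
From mathcomp Require Import ring lra zify.

Set Implicit Arguments.
Unset Strict Implicit.
Unset Printing Implicit Defensive.

Import Order.TTheory GRing.Theory Num.Theory.
Local Open Scope ring_scope.

Definition add2_head (s : seq nat) : seq nat :=
  if s is a :: s' then a.+2 :: s' else [::].

(* At [n = 0] this is [[::]] rather than [[:: [::]]], to match [fib 0 = 0]. *)
Fixpoint odd_compositions (n : nat) : seq (seq nat) :=
  match n with
  | 0 => [::]
  | 1 => [:: [:: 1%N]]
  | (m.+1 as n1).+1 => [seq 1%N :: s | s <- odd_compositions n1]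
                       ++ [seq add2_head s | s <- odd_compositions m]
  end.

Lemma fibSS n : fib n.+2 = (fib n.+1 + fib n)%N.
Proof. by []. Qed.

Lemma odd_compositionsSS n :
  odd_compositions n.+2 = [seq 1%N :: s | s <- odd_compositions n.+1]
                          ++ [seq add2_head s | s <- odd_compositions n].
Proof. by []. Qed.

Lemma size_odd_compositions n : size (odd_compositions n) = fib n.
Proof.
suff [] : size (odd_compositions n) = fib n
  /\ size (odd_compositions n.+1) = fib n.+1 by [].
elim: n => [//|n [IH0 IH1]]; split=> //.
by rewrite odd_compositionsSS size_cat !size_map IH0 IH1.
Qed.

(** Split on the first part: a leading 1 is removed, leaving a composition of [n - 1]; a leading
    part that is at least 3 drops by two, stays odd, and leaves a composition of [n - 2]. *)
Lemma mem_odd_compositions n s :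
  (0 < n)%N -> all odd s -> sumn s = n -> s \in odd_compositions n.
Proof.
elim/ltn_ind: n s => -[//|[|n]] IH [//|a s] _ /= /andP[odd_a odd_s] sum_s.
- case: a odd_a sum_s => [//|[|a]] _ /=; last lia.
  case: s odd_s => [//|b s] /= /andP[odd_b _] sum_s.
  by case: b odd_b sum_s => [//|b]; lia.
- rewrite -/(odd_compositions n.+2) odd_compositionsSS mem_cat.
  case: a odd_a sum_s => [//|[|a]] odd_a sum_s; apply/orP.
    by left; apply/map_f/IH => //; lia.
  right; apply/mapP; exists (a :: s) => //.
  rewrite /= negbK in odd_a.
  apply: IH => //=; [|by rewrite odd_a|lia].
  by case: a odd_a sum_s => //=; lia.
Qed.

Lemma num_odd_partitions_le_fib n :
  (0 < n)%N -> (num_odd_partitions n <= fib n)%N.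
Proof.
move=> n_gt0; rewrite -size_odd_compositions /num_odd_partitions cardE.
pose f (t : n.-bseq 'I_n.+1) := [seq val i | i <- t].
have f_inj : injective f by move=> s t /(inj_map val_inj)/val_inj.
rewrite -(size_map f); apply: uniq_leq_size.
  by rewrite map_inj_uniq ?enum_uniq.
move=> s /mapP[t]; rewrite mem_enum inE => /and3P[_ odd_t /eqP sum_t] ->.
exact: mem_odd_compositions.
Qed.

(** Extends [S_] to integer indices, so that the shifts by 1 and 2 in Pascal's rule need no case
    split near 0. *)
Definition Sz (z : int) (k : nat) : nat :=
  (\sum_(0 <= j < k.+1) 'C(k, j) * q (z - k%:Z - j%:Z)%R)%N.

Lemma SzS z k : Sz z k.+1 = (Sz (z - 1) k + Sz (z - 2) k)%N.
Proof.
rewrite /Sz [LHS]big_nat_recl // bin0.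
under eq_bigr do rewrite binS mulnDl.
rewrite big_split /= addnA; congr (_ + _)%N.
  (* The top term has the binomial ['C(k, k.+1)], which is 0; the term [j = 0] split off earlier
     completes the sum for [z - 1]. *)
  rewrite [X in (_ + X)%N]big_nat_recr //= bin_small // mul0n addn0.
  rewrite [RHS]big_nat_recl // bin0; congr (_ + _)%N.
    by congr (_ * q _)%N; lia.
  by apply: eq_bigr => j _; congr (_ * q _)%N; lia.
by apply: eq_bigr => j _; congr (_ * q _)%N; lia.
Qed.

Lemma Sz_lt0 z k : z < 0 -> Sz z k = 0%N.
Proof.
move=> z_lt0; rewrite /Sz big1 // => j _.
suff : z - k%:Z - j%:Z < 0 by case: (z - k%:Z - j%:Z) => // ?; rewrite muln0.
lia.
Qed.

Lemma S_0S k : S_ 0 k.+1 = 0%N.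
Proof. by rewrite -[LHS]/(Sz 0 k.+1) SzS !Sz_lt0. Qed.

Lemma S_1S k : S_ 1 k.+1 = S_ 0 k.
Proof. by rewrite -[LHS]/(Sz 1 k.+1) SzS [X in (_ + X)%N]Sz_lt0 // addn0. Qed.

Lemma S_SS n k : S_ n.+2 k.+1 = (S_ n.+1 k + S_ n k)%N.
Proof.
rewrite -[LHS]/(Sz n.+2 k.+1) SzS.
by congr (Sz _ k + Sz _ k)%N; lia.
Qed.

(** Lowering [k] by one lowers the threshold [2 * k] by two, which matches the lag of both
    recurrences. At [k = 0] it excludes [n = 0], where [q 0 = 1] exceeds [fib 0]. *)
Lemma S_le_fib n k : (2 * k < n)%N -> (S_ n k <= fib n)%N.
Proof.
elim: k n => [|k IH] n lt_kn.
  rewrite /S_ big_nat1 bin0 mul1n !subr0.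
  exact: num_odd_partitions_le_fib.
case: n lt_kn => [|[|n]] lt_kn; [lia..|].
by rewrite S_SS fibSS leq_add // IH //; lia.
Qed.

(** Truncated form of the generating function identity [B = x + (x + x ^+ 2) * A]. In degree [m.+2]
    the product supplies only [a m], so [a m.+1] is added by hand. *)
Lemma sum_shifted_recurrence (R : comNzRingType) (a b : nat -> R) (x : R) m :
  b 0 = 0 -> b 1 = 1 + a 0 -> (forall n, b n.+2 = a n.+1 + a n) ->
  \sum_(0 <= n < m.+3) b n * x ^+ n =
    x + (x + x ^+ 2) * (\sum_(0 <= n < m.+1) a n * x ^+ n)
      + a m.+1 * x ^+ m.+2.
Proof.
move=> b0 b1 bSS; elim: m => [|m IH].
  by rewrite !big_nat_recr //= !big_nil b0 b1 bSS; ring.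
rewrite big_nat_recr //= IH [in RHS]big_nat_recr //= bSS !exprS; ring.
Qed.

Lemma R_E (R : realType) (k : nat) (x : R) : 0 < x ->
  R_ k x = (x / (1 - x - x ^+ 2)
            - \sum_(0 <= n < (2 * k).+1) ((fib n)%:R - (S_ n k)%:R) * x ^+ n)
           / (x ^+ k * (1 + x) ^+ k).
Proof.
move=> x_gt0; have x_neq0 : x != 0 by rewrite gt_eqF.
rewrite /R_ expfzDr // exprN1 -exprnP !invfM invrK; ring.
Qed.

Theorem theorem6 (R : realType) (k : nat) (x : R)
  (x_gt0 : 0 < x) (x_ne : x ^+ 2 + x != 1) :
  R_ k.+1 x - R_ k x <= 0.
Proof.
have d_neq0 : 1 - x - x ^+ 2 != 0.
  by apply: contra x_ne => /eqP d0; apply/eqP; lra.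
have x1_gt0 : 0 < 1 + x by lra.
have [x_neq0 x1_neq0] : x != 0 /\ 1 + x != 0 by split; rewrite gt_eqF.
rewrite !R_E //.
have -> : (2 * k.+1).+1 = (2 * k).+3 by lia.
rewrite (@sum_shifted_recurrence _ (fun n => (fib n)%:R - (S_ n k)%:R)); last first.
- by move=> n; rewrite S_SS fibSS !natrD; ring.
- by rewrite S_1S /=; ring.
- by rewrite S_0S subr0.
set P := \sum_(0 <= n < _) _; set d := _ - (S_ _ k)%:R.
(* The leftover index [2k + 1] is the first one that [S_le_fib] covers. *)
have d_ge0 : 0 <= d by rewrite subr_ge0 ler_nat S_le_fib.
(* With [G = x / (1 - x - x ^+ 2)] one has [G - x = (x + x ^+ 2) * G], so [G - x - (x + x ^+ 2) * P]
   is [x * (1 + x) * (G - P)]. The extra denominator cancels this factor and only the [d] term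
   survives. *)
have -> : (x / (1 - x - x ^+ 2) - (x + (x + x ^+ 2) * P + d * x ^+ (2 * k).+2))
    / (x ^+ k.+1 * (1 + x) ^+ k.+1)
    - (x / (1 - x - x ^+ 2) - P) / (x ^+ k * (1 + x) ^+ k)
  = - (d * x ^+ (2 * k).+2 / (x ^+ k.+1 * (1 + x) ^+ k.+1)).
  rewrite ![_ ^+ k.+1]exprS; field.
  by rewrite d_neq0 x_neq0 x1_neq0 !expf_neq0.
have [x_ge0 x1_ge0] : 0 <= x /\ 0 <= 1 + x by split; exact: ltW.
by rewrite oppr_le0; apply: divr_ge0; apply: mulr_ge0 => //; apply: exprn_ge0.
Qed.
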